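(* Let $F$ be a field of characteristic not two and let $E$ be a finite-dimensional vector space over $F$ with an arbitrary symmetric bilinear form $(U,V)\mapsto U\cdot V$. Suppose the non-null projective triangle $\overline{uvw}$ in $E$ has projective quadrances $q_u=q(v,w)$, $q_v=q(u,w)$, $q_w=q(u,v)$, and projective spreads $S_u=S(uv,uw)$, $S_v=S(vw,vu)$, $S_w=S(wu,wv)$ (all three assumed to be defined). Then $$\frac{S_u}{q_u}=\frac{S_v}{q_v}=\frac{S_w}{q_w}.$$
   Context: A projective point $u=[U]$ is a one-dimensional subspace of $E$, spanned by a non-zero vector $U$; it is null if $U\cdot U=0$, and non-null otherwise. For distinct projective points $u,v$, $uv$ denotes the projective line (two-dimensional subspace) they span. A projective triangle $\overline{uvw}$ is a set of three distinct projective points not contained in a common two-dimensional subspace; it is null if at least one of its projective points is null, and non-null otherwise. The projective quadrance between non-null projective points $u=[U]$, $v=[V]$ is $$q(u,v)=1-\frac{(U\cdot V)^2}{(U\cdot U)(V\cdot V)}.$$ The projective spread between the projective lines $wu$ and $wv$, where $u=[U]$, $v=[V]$, $w=[W]$ with $w$ non-null, is, putting $U'=U-\frac{U\cdot W}{W\cdot W}W$ and $V'=V-\frac{V\cdot W}{W\cdot W}W$, $$S(wu,wv)=1-\frac{(U'\cdot V')^2}{(U'\cdot U')(V'\cdot V')},$$ and it is undefined if one of the denominators is zero. Equivalently, with $a_X=X\cdot X$ and $b_{XY}=X\cdot Y$, $$S(wu,wv)=1-\frac{(a_Wb_{UV}-b_{UW}b_{VW})^2}{(a_Ua_W-b_{UW}^2)(a_Va_W-b_{VW}^2)}.$$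 (So all three spreads of a non-null projective triangle are defined exactly when its three projective quadrances are non-zero.) The bilinear form is not assumed non-degenerate. *)

(* Defs.v *)
From mathcomp Require Import all_boot all_algebra.
From mathcomp Require Import ring.

Set Implicit Arguments.
Unset Strict Implicit.
Unset Printing Implicit Defensive.

Import GRing.Theory.
Local Open Scope ring_scope.

Section ProjectiveTrigonometry.
Variables (F : fieldType) (E : vectType F) (B : {symmetric E}).
Implicit Types (u v w l m : {vspace E}) (U V W : E).

(* Points and lines are subspaces of E; the line through u and v is u + v.
   The definitions below fix representatives with vpick, but the values do not
   depend on this choice: see null_pointE, quadranceE, spreadE and
   spread_definedE. *)
Definition proj_point u : bool := \dim u == 1%N.

Definition null_point u : bool := B (vpick u) (vpick u) == 0.

Definition proj_triangle u v w : Prop :=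
  [/\ [&& proj_point u, proj_point v & proj_point w],
      uniq [:: u; v; w]
    & ~ exists l, [/\ \dim l = 2%N, (u <= l)%VS, (v <= l)%VS & (w <= l)%VS]].

Definition null_triangle u v w : bool :=
  [|| null_point u, null_point v | null_point w].

Definition vquadrance U V : F := 1 - B U V ^+ 2 / (B U U * B V V).

Definition quadrance u v : F := vquadrance (vpick u) (vpick v).

Definition vreject W U : E := U - (B U W / B W W) *: W.

(* For two distinct lines l and m meeting in a point w = [W], l :\: m is a
   point [U] of l other than w, so that l = wu; arm l m is then the vector U'
   orthogonal to W, and arm m l is the corresponding V'. *)
Definition apex l m : E := vpick (l :&: m).

Definition arm l m : E := vreject (apex l m) (vpick (l :\: m)).

Definition spread l m : F := vquadrance (arm l m) (arm m l).

(* Inversion is total, with 0^-1 = 0, so spread only has its intended value when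
   its denominators are non-zero. *)
Definition spread_defined l m : bool :=
  [&& B (apex l m) (apex l m) != 0,
      B (arm l m) (arm l m) != 0 & B (arm m l) (arm m l) != 0].

Lemma bformC U V : B U V = B V U.
Proof. by rewrite [LHS]hermitian_subproof expr0 mul1r. Qed.

Lemma bformDl U V W : B (U + V) W = B U W + B V W.
Proof. by rewrite linearDl. Qed.

Lemma bformZl a U V : B (a *: U) V = a * B U V.
Proof. by rewrite linearZl_LR. Qed.

Lemma bformDr U V W : B W (U + V) = B W U + B W V.
Proof. by rewrite bformC bformDl !(bformC W). Qed.

Lemma bformZr a U V : B V (a *: U) = a * B V U.
Proof. by rewrite bformC bformZl bformC. Qed.

Definition bformE := (bformDl, bformDr, bformZl, bformZr).

Lemma vpick_line U : U != 0 -> exists2 c, c != 0 & vpick <[U]> = c *: U.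
Proof.
move=> U0; have /vlineP[c e] := memv_pick <[U]>; exists c => //.
apply: contraNneq U0 => c0; move/eqP: e; rewrite c0 scale0r vpick0.
by rewrite -dimv_eq0 dim_vline; case: (U == 0).
Qed.

Lemma vquadranceZ a b U V : a != 0 -> b != 0 ->
  vquadrance (a *: U) (b *: V) = vquadrance U V.
Proof.
move=> a0 b0; rewrite /vquadrance !bformE; congr (1 - _).
have [-> | U0] := eqVneq (B U U) 0; first by rewrite !(mulr0, mul0r) !invr0 !mulr0.
have [-> | V0] := eqVneq (B V V) 0; first by rewrite !(mulr0, mul0r) !invr0 !mulr0.
by field; rewrite U0 V0 a0 b0.
Qed.

Lemma null_pointE U : U != 0 -> null_point <[U]> = (B U U == 0).
Proof.
move=> /vpick_line[c c0 e]; rewrite /null_point e !bformE.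
by rewrite !mulf_eq0 (negPf c0).
Qed.

Lemma quadranceE U V : U != 0 -> V != 0 ->
  quadrance <[U]> <[V]> = 1 - B U V ^+ 2 / (B U U * B V V).
Proof.
move=> /vpick_line[a a0 eU] /vpick_line[b b0 eV].
by rewrite /quadrance eU eV vquadranceZ.
Qed.

Lemma free3 U V W : free [:: W; U; V] ->
  [/\ W != 0, U \notin (<[W]> + <[V]>)%VS & V \notin (<[W]> + <[U]>)%VS].
Proof.
move=> f; split.
- by apply: contraTneq f => ->; rewrite free_cons mem0v.
- have: free [:: U; W; V].
    by rewrite -(perm_free (X := [:: W; U; V])) //; apply/permP=> p /=; ring.
  by rewrite free_cons span_cons span_seq1 => /andP[].
- have: free [:: V; W; U].
    by rewrite -(perm_free (X := [:: W; U; V])) //; apply/permP=> p /=; ring.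
  by rewrite free_cons span_cons span_seq1 => /andP[].
Qed.

Lemma freeC3 U V W : free [:: W; U; V] -> free [:: W; V; U].
Proof.
by move=> f; rewrite -(perm_free (X := [:: W; U; V])) //; apply/permP=> p /=; ring.
Qed.

Lemma apexE U V W : free [:: W; U; V] ->
  exists2 c, c != 0 & apex (<[W]> + <[U]>) (<[W]> + <[V]>) = c *: W.
Proof.
case/free3=> W0 nU nV; rewrite /apex; set l := (_ + _)%VS; set m := (_ + _)%VS.
have Wl : W \in l := subvP (addvSl _ _) _ (memv_line W).
have Wm : W \in m := subvP (addvSl _ _) _ (memv_line W).
have x0 : vpick (l :&: m) != 0.
  rewrite vpick0; apply: contraNneq W0 => lm0.
  by rewrite -memv0 -lm0 memv_cap Wl Wm.
have: vpick (l :&: m) \in (l :&: m)%VS by exact: memv_pick.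
rewrite memv_cap => /andP[/memv_addP[_ /vlineP[a ->] [_ /vlineP[b ->] e]]].
rewrite e rpredDl; last exact: rpredZ.
rewrite rpredZeq (negPf nU) orbF => /eqP b0.
exists a; last by rewrite b0 scale0r addr0.
by apply: contraNneq x0 => a0; rewrite e a0 b0 !scale0r addr0.
Qed.

Lemma armE U V W : B W W != 0 -> free [:: W; U; V] ->
  exists2 c, c != 0 &
    arm (<[W]> + <[U]>) (<[W]> + <[V]>) = c *: vreject W U.
Proof.
move=> WW f; have [c c0 eW] := apexE f; case/free3: f => W0 nU nV.
rewrite /arm eW {eW}; set l := (_ + <[U]>)%VS; set m := (_ + <[V]>)%VS in nU *.
have Wm : W \in m := subvP (addvSl _ _) _ (memv_line W).
have Ul : U \in l := subvP (addvSr _ _) _ (memv_line U).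
have x0 : vpick (l :\: m) != 0.
  by rewrite vpick0 diffv_eq0; apply: contraNN nU => /subvP; apply.
have xd : vpick (l :\: m) \in (l :\: m)%VS by exact: memv_pick.
have nxm : vpick (l :\: m) \notin m.
  by apply: contraNN x0 => xm; rewrite -memv0 -(capv_diff l m) memv_cap xd.
have := subvP (diffvSl _ _) _ xd.
case/memv_addP=> _ /vlineP[a ->] [_ /vlineP[b ->] e]; exists b.
  by apply: contraNneq nxm => b0; rewrite e b0 scale0r addr0 rpredZ.
rewrite e /vreject !bformE scalerA.
have -> : (a * (c * B W W) + b * (c * B U W)) / (c * (c * B W W)) * c
          = a + b * (B U W / B W W) by field; rewrite c0 WW.
by rewrite scalerBr scalerA scalerDl opprD addrACA addrA subrr add0r.
Qed.

Lemma spreadE U V W : B W W != 0 -> free [:: W; U; V] ->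
  let U' := U - (B U W / B W W) *: W in
  let V' := V - (B V W / B W W) *: W in
  spread (<[W]> + <[U]>) (<[W]> + <[V]>)
    = 1 - B U' V' ^+ 2 / (B U' U' * B V' V').
Proof.
move=> WW f /=; rewrite /spread.
have [a a0 ->] := armE WW f; have [b b0 ->] := armE WW (freeC3 f).
by rewrite vquadranceZ.
Qed.

Lemma spread_definedE U V W : B W W != 0 -> free [:: W; U; V] ->
  let U' := U - (B U W / B W W) *: W in
  let V' := V - (B V W / B W W) *: W in
  spread_defined (<[W]> + <[U]>) (<[W]> + <[V]>)
    = (B U' U' != 0) && (B V' V' != 0).
Proof.
move=> WW f /=; rewrite /spread_defined.
have [c c0 ->] := apexE f.
have [a a0 ->] := armE WW f; have [b b0 ->] := armE WW (freeC3 f).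
by rewrite !bformE !mulf_eq0 (negPf a0) (negPf b0) (negPf c0) (negPf WW).
Qed.

End ProjectiveTrigonometry.

(* Main.v *)
Require Import Defs.
From mathcomp Require Import all_boot all_algebra.
From mathcomp Require Import ring.
Set Implicit Arguments.
Unset Strict Implicit.
Unset Printing Implicit Defensive.
Import GRing.Theory.
Local Open Scope ring_scope.

(** Choose spanning vectors [U], [V], [W] of the three points, and let
    [gram2 X Y] and [gram3 U V W] be the Gram determinants of the pair [X, Y]
    and of the whole triple. A quadrance is a normalized Gram determinant,
    [q_w = gram2 U V / ((U.U) (V.V))]. The vectors that define [S_w] are the
    components of [U] and [V] orthogonal to [W], so their Gram determinants
    are Schur complements with respect to [W.W], whence
    [S_w = (W.W) gram3 U V W / (gram2 U W * gram2 V W)].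
    Therefore
    [S_w / q_w = (U.U) (V.V) (W.W) gram3 U V W
                  / (gram2 U V * gram2 V W * gram2 W U)],
    and the right-hand side is invariant under cyclic permutation of the three
    vectors, so the three ratios agree ([spread_quadrance_ratio] and
    [sine_ratio_rot]). *)

Section SineLaw.
Variables (F : fieldType) (E : vectType F) (B : {symmetric E}).
Implicit Types (U V W : E) (u v w : {vspace E}).

Definition gram2 U V : F := B U U * B V V - B U V ^+ 2.

Definition gram3 U V W : F :=
  B U U * B V V * B W W + B U V * B V W * B W U *+ 2
  - B U U * B V W ^+ 2 - B V V * B W U ^+ 2 - B W W * B U V ^+ 2.

Definition sine_ratio U V W : F :=
  B U U * B V V * B W W * gram3 U V W / (gram2 U V * gram2 V W * gram2 W U).

Lemma sine_ratio_rot U V W : sine_ratio V W U = sine_ratio U V W.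
Proof.
by rewrite /sine_ratio; congr (_ / _); [rewrite /gram3|]; ring.
Qed.

Lemma gram2C U V : gram2 U V = gram2 V U.
Proof. by rewrite /gram2 (bformC B U V) mulrC. Qed.

Lemma quadranceC u v : quadrance B u v = quadrance B v u.
Proof.
by rewrite /quadrance /vquadrance bformC [X in _ / X]mulrC.
Qed.

Lemma vquadrance_gram2 U V : B U U != 0 -> B V V != 0 ->
  vquadrance B U V = gram2 U V / (B U U * B V V).
Proof.
by move=> UU VV; rewrite /vquadrance /gram2; field; rewrite UU VV.
Qed.

Lemma vreject_form U V W : B W W != 0 ->
  B (vreject B W U) (vreject B W V)
    = (B W W * B U V - B U W * B V W) / B W W.
Proof.
move=> WW; rewrite /vreject -!scaleNr !bformE (bformC B W V).
by field.
Qed.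

Lemma vreject_norm U W : B W W != 0 ->
  B (vreject B W U) (vreject B W U) = gram2 U W / B W W.
Proof. by move=> WW; rewrite vreject_form // /gram2; congr (_ / _); ring. Qed.

(** Sylvester's identity for the triple: the determinant of the Schur
    complement of [W.W], cleared of denominators. *)
Lemma gram2_gram3 U V W :
  gram2 U W * gram2 V W - (B W W * B U V - B U W * B V W) ^+ 2
    = B W W * gram3 U V W.
Proof. by rewrite /gram2 /gram3 (bformC B W U); ring. Qed.

Lemma vquadrance_vreject U V W : B W W != 0 ->
  gram2 U W != 0 -> gram2 V W != 0 ->
  vquadrance B (vreject B W U) (vreject B W V)
    = B W W * gram3 U V W / (gram2 U W * gram2 V W).
Proof.
move=> WW gU gV; rewrite -gram2_gram3 /vquadrance !vreject_norm //.
by rewrite vreject_form //; field; rewrite WW gU gV.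
Qed.

Lemma spread_defined_gram2 U V W : B W W != 0 -> free [:: W; U; V] ->
  spread_defined B (<[W]> + <[U]>) (<[W]> + <[V]>)
    = (gram2 U W != 0) && (gram2 V W != 0).
Proof.
move=> WW f; rewrite spread_definedE // -!/(vreject B W _) !vreject_norm //.
by rewrite !mulf_eq0 invr_eq0 (negPf WW) !orbF.
Qed.

(** The ratio at [W] is a function of the triple that treats its three
    members alike, which is the whole content of the law. *)
Lemma spread_quadrance_ratio U V W :
    B U U != 0 -> B V V != 0 -> B W W != 0 -> free [:: W; U; V] ->
    gram2 U V != 0 -> gram2 V W != 0 -> gram2 W U != 0 ->
  spread B (<[W]> + <[U]>) (<[W]> + <[V]>) / quadrance B <[U]> <[V]>
    = sine_ratio U V W.
Proof.
move=> UU VV WW f gUV gVW gWU.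
have U0 : U != 0 by apply: contraNneq UU => ->; rewrite linear0.
have V0 : V != 0 by apply: contraNneq VV => ->; rewrite linear0.
rewrite spreadE // quadranceE // -!/(vreject B W _) -!/(vquadrance B _ _).
rewrite vquadrance_vreject // ?(gram2C U W) // vquadrance_gram2 //.
by rewrite /sine_ratio; field; rewrite UU VV gUV gVW gWU.
Qed.

Lemma proj_pointE u : proj_point u -> u = <[vpick u]>%VS.
Proof.
move=> /eqP du; apply/esym/eqP.
rewrite eqEdim -memvE memv_pick du dim_vline vpick0.
by rewrite -dimv_eq0 du.
Qed.

(** If the three vectors were dependent, the line through the two distinct
    points [v] and [w] would contain [u]. *)
Lemma proj_triangle_free u v w : proj_triangle u v w ->
  free [:: vpick u; vpick v; vpick w].
Proof.
case=> /and3P[pu pv pw]; rewrite /= !inE => /and3P[_ nvw _] noline.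
have vpick_neq0 x : proj_point x -> vpick x != 0.
  by move=> /eqP dx; rewrite vpick0 -dimv_eq0 dx.
have free_vw : free [:: vpick v; vpick w].
  rewrite free_cons span_seq1 seq1_free vpick_neq0 // andbT.
  apply: contraNN nvw => vw; rewrite eqEdim (eqP pv) (eqP pw) leqnn andbT.
  by rewrite (proj_pointE pv) (proj_pointE pw) -memvE.
rewrite free_cons free_vw andbT; apply/negP => uvw; apply: noline.
exists <<[:: vpick v; vpick w]>>%VS; split.
- exact/eqP.
- by rewrite (proj_pointE pu) -memvE.
- by rewrite {1}(proj_pointE pv) -memvE memv_span ?mem_head.
- by rewrite {1}(proj_pointE pw) -memvE memv_span ?inE ?eqxx ?orbT.
Qed.

Lemma free_rot (X : seq E) n : free (rot n X) = free X.
Proof. by apply: perm_free; rewrite perm_rot. Qed.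

End SineLaw.

Theorem theorem9 (F : fieldType) (charF : 2%N \notin [pchar F])
  (E : vectType F) (B : {symmetric E}) (u v w : {vspace E}) :
  proj_triangle u v w ->
  ~~ null_triangle B u v w ->
  spread_defined B (u + v) (u + w) ->
  spread_defined B (v + w) (v + u) ->
  spread_defined B (w + u) (w + v) ->
  let q_u := quadrance B v w in
  let q_v := quadrance B u w in
  let q_w := quadrance B u v in
  let S_u := spread B (u + v) (u + w) in
  let S_v := spread B (v + w) (v + u) in
  let S_w := spread B (w + u) (w + v) in
  S_u / q_u = S_v / q_v /\ S_v / q_v = S_w / q_w.
Proof.
move=> tri; rewrite /null_triangle !negb_or => /and3P[UU VV WW].
have fU := proj_triangle_free tri.
have fV := fU; rewrite -(free_rot _ 1) in fV.
have fW := fV; rewrite -(free_rot _ 1) in fW.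
case: tri => /and3P[/proj_pointE -> /proj_pointE -> /proj_pointE ->] _ _.
rewrite /null_point in UU VV WW.
move: (vpick u) (vpick v) (vpick w) UU VV WW fU fV fW => U V W UU VV WW fU fV fW.
rewrite !spread_defined_gram2 // => /andP[gVU gWU] /andP[gWV _] _ /=.
have gUV : gram2 B U V != 0 by rewrite gram2C.
have gVW : gram2 B V W != 0 by rewrite gram2C.
rewrite (quadranceC B <[U]> <[W]>) !spread_quadrance_ratio //.
by rewrite 2!sine_ratio_rot -(sine_ratio_rot B W U V).
Qed.
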